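(* Consider the time-delay system $$\dot x(t)=Ax(t)+f\big(x(t),x(t-\tau),u(t),u(t-\tau)\big),\quad t\ge 0,\qquad y(t)=Cx(t),\qquad x(s)=\varphi(s),\ s\in[-\tau,0],$$ where $x(t)\in\mathbb{R}^n$, $u(t)\in\mathbb{R}^m$, $y(t)\in\mathbb{R}$, the delay $\tau>0$ is constant and known, and $A$, $C$, $f$ are as described in the context. Suppose that $f$ satisfies Assumption A1 of the context, with functions $\gamma_1,\gamma_2,\gamma_3$. Let $L=[l_1,\dots,l_n]^T\in\mathbb{R}^n$ be such that $A_L:=A+LC$ is Hurwitz, and let $P$ be the symmetric positive definite solution of $A_L^TP+PA_L=-I$. Suppose that there exists $\varepsilon>0$ such that $$\frac{\lambda_{\min}(P)}{\varepsilon\|P\|}-2n\gamma_1(\varepsilon)\|P\|-n^2\gamma_2^2(\varepsilon)\|P\|^2-1>0.$$ Then, for such $\varepsilon$, with $L(\varepsilon)=\left[\frac{l_1}{\varepsilon},\dots,\frac{l_n}{\varepsilon^n}\right]^T$, the system $$\dot{\hat x}(t)=A\hat x(t)+f\big(\hat x(t),\hat x(t-\tau),u(t),u(t-\tau)\big)+L(\varepsilon)\big(C\hat x(t)-y(t)\big),\qquad \hat y(t)=C\hat x(t),$$ is a globally exponential observer for the given system. That is, the dynamics of the observation error $e=\hat x-x$ are globally exponentially stable: there exist $\alpha>0$ and $\beta>0$ such that, for all continuous initial functions of $x$ and $\hat x$ on $[-\tau,0]$ and all $t\ge 0$, $$\|e(t)\|\le \beta\,\Big(\max_{s\in[-\tau,0]}\|e(s)\|\Big)\,e^{-\alpha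 t}.$$
   Context: $\|\cdot\|$ is the Euclidean norm on vectors and the induced norm on matrices; $\lambda_{\min}(P)$ is the smallest eigenvalue of $P$. Initial functions are continuous maps $[-\tau,0]\to\mathbb{R}^n$. The matrix $A\in\mathbb{R}^{n\times n}$ has entries $A_{i,i+1}=1$ for $1\le i\le n-1$ and all other entries $0$; $C=[1,0,\dots,0]\in\mathbb{R}^{1\times n}$. The map $f=[f_1,\dots,f_n]^T$ has components $f_i:\mathbb{R}^n\times\mathbb{R}^n\times\mathbb{R}^m\times\mathbb{R}^m\to\mathbb{R}$ that are smooth with $f_i(0,0,0,0)=0$. Assumption A1: there exist functions $\gamma_1(\varepsilon)>0$, $\gamma_2(\varepsilon)>0$, $\gamma_3(\varepsilon)>0$ such that for every $\varepsilon>0$ and all $x,y,\bar x,\bar y\in\mathbb{R}^n$, $u,v,\bar v\in\mathbb{R}^m$ (here $v,\bar v$ stand for values of the delayed input), $$\sum_{i=1}^n\varepsilon^{i-1}|f_i(x,\bar x,u,v)-f_i(y,\bar y,u,v)|\le\gamma_1(\varepsilon)\sum_{i=1}^n\varepsilon^{i-1}|x_i-y_i|+\gamma_2(\varepsilon)\sum_{i=1}^n\varepsilon^{i-1}|\bar x_i-\bar y_i|,$$ $$\sum_{i=1}^n\varepsilon^{i-1}|f_i(x,\bar x,u,v)-f_i(x,\bar y,u,\bar v)|\le\gamma_2(\varepsilon)\sum_{i=1}^n\varepsilon^{i-1}|\bar x_i-\bar y_i|+\gamma_3(\varepsilon)\sum_{i=1}^n\varepsilon^{i-1}\|v-\bar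 v\|.$$ The input $u$ is a given function on $[-\tau,\infty)$ with values in $\mathbb{R}^m$, regular enough (e.g. continuous) for the solutions to be defined. The initial time is $t_0=0$. *)

(* Defs.v *)
From mathcomp Require Export all_boot all_order all_algebra.
From mathcomp Require Export all_classical all_reals all_analysis.
From mathcomp Require Export complex.

Set Implicit Arguments.
Unset Strict Implicit.
Unset Printing Implicit Defensive.

Export Order.TTheory GRing.Theory Num.Theory.
Export numFieldNormedType.Exports.

Global Open Scope classical_set_scope.
Global Open Scope ring_scope.

(* The library norm `|x| on matrices is the max norm; it is used only through
   the topology (limits, continuity, derivatives), which is the usual one. *)
Definition enorm (R : realType) (n : nat) (x : 'cV[R]_n) : R :=
  Num.sqrt (\sum_(i < n) x i 0 ^+ 2).

Definition opnorm (R : realType) (m n : nat) (M : 'M[R]_(m, n)) : R :=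
  sup [set enorm (M *m x) | x in [set x : 'cV[R]_n | enorm x <= 1]].

(* For symmetric M of positive size the set of real eigenvalues is finite and
   nonempty, so that this infimum is the smallest eigenvalue. *)
Definition lambda_min (R : realType) (n : nat) (M : 'M[R]_n) : R :=
  inf [set a : R | eigenvalue M a].

Definition posdefmx (R : realType) (n : nat) (M : 'M[R]_n) : Prop :=
  M^T = M /\ forall x : 'cV[R]_n, x != 0 -> 0 < (x^T *m M *m x) 0 0.

Definition hurwitz (R : realType) (n : nat) (M : 'M[R]_n) : Prop :=
  forall z : R[i], eigenvalue (map_mx (real_complex R) M) z -> complex.Re z < 0.

(* Class C^k: all iterated directional derivatives (in particular all partial
   derivatives) of order at most k exist and are continuous. *)
Fixpoint class_C (R : realType) (V : normedModType R) (k : nat) (g : V -> R)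
    {struct k} : Prop :=
  continuous g /\
  match k with
  | 0 => True
  | k'.+1 => forall v : V,
      (forall x, derivable g x v) /\ class_C k' (fun x => 'D_v g x)
  end.

Definition smooth (R : realType) (V : normedModType R) (g : V -> R) : Prop :=
  forall k, class_C k g.

(* Indices start at 0, so that the weight epsilon^(i-1) of the 1-based
   component i becomes eps ^+ i, and epsilon^i becomes eps ^+ i.+1. *)
Definition chain_mx (R : realType) (n : nat) : 'M[R]_n :=
  \matrix_(i, j) ((j == i.+1 :> nat)%:R).

Definition out_mx (R : realType) (n : nat) : 'rV[R]_n :=
  \row_j ((j == 0%N :> nat)%:R).

Definition gain (R : realType) (n : nat) (L : 'cV[R]_n) (eps : R) : 'cV[R]_n :=
  \col_i (L i 0 / eps ^+ i.+1).

Definition wnorm1 (R : realType) (n : nat) (eps : R) (x : 'cV[R]_n) : R :=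
  \sum_(i < n) eps ^+ i * `|x i 0|.

Definition vfield (R : realType) (n m : nat)
    (f : 'I_n -> 'cV[R]_n -> 'cV[R]_n -> 'cV[R]_m -> 'cV[R]_m -> R)
    (x xb : 'cV[R]_n) (u v : 'cV[R]_m) : 'cV[R]_n :=
  \col_i f i x xb u v.

Definition assumptionA1 (R : realType) (n m : nat)
    (f : 'I_n -> 'cV[R]_n -> 'cV[R]_n -> 'cV[R]_m -> 'cV[R]_m -> R)
    (gamma1 gamma2 gamma3 : R -> R) : Prop :=
  forall eps : R, 0 < eps ->
  [/\ 0 < gamma1 eps, 0 < gamma2 eps, 0 < gamma3 eps &
    forall (x y xb yb : 'cV[R]_n) (u v vb : 'cV[R]_m),
      wnorm1 eps (vfield f x xb u v - vfield f y yb u v)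
        <= gamma1 eps * wnorm1 eps (x - y) + gamma2 eps * wnorm1 eps (xb - yb)
      /\
      wnorm1 eps (vfield f x xb u v - vfield f x yb u vb)
        <= gamma2 eps * wnorm1 eps (xb - yb)
           + gamma3 eps * \sum_(i < n) eps ^+ i * enorm (v - vb)].

(* Classical solutions on [-tau, +oo[ of z'(t) = F t (z t) (z (t - tau)),
   t >= 0, with initial function phi; z'(0) is the right derivative, and the
   values of z and phi outside the relevant intervals are irrelevant. *)
Definition dde_solution (R : realType) (n : nat) (tau : R)
    (F : R -> 'cV[R]_n -> 'cV[R]_n -> 'cV[R]_n) (phi z : R -> 'cV[R]_n) : Prop :=
  [/\ forall s : R, - tau <= s <= 0 -> z s = phi s,
      {within `[- tau, +oo[, continuous z},
      h^-1 *: (z h - z 0) @[h --> 0^'+] --> F 0 (z 0) (z (- tau)) &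
      forall t : R, 0 < t -> is_derive t 1 z (F t (z t) (z (t - tau)))].

Definition plant (R : realType) (n m : nat)
    (f : 'I_n -> 'cV[R]_n -> 'cV[R]_n -> 'cV[R]_m -> 'cV[R]_m -> R)
    (tau : R) (u : R -> 'cV[R]_m) (t : R) (x xd : 'cV[R]_n) : 'cV[R]_n :=
  chain_mx R n *m x + vfield f x xd (u t) (u (t - tau)).

Definition output (R : realType) (n : nat) (x : 'cV[R]_n) : R :=
  (out_mx R n *m x) 0 0.

Definition observer (R : realType) (n m : nat)
    (f : 'I_n -> 'cV[R]_n -> 'cV[R]_n -> 'cV[R]_m -> 'cV[R]_m -> R)
    (tau : R) (u : R -> 'cV[R]_m) (K : 'cV[R]_n) (y : R -> R)
    (t : R) (xh xhd : 'cV[R]_n) : 'cV[R]_n :=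
  chain_mx R n *m xh + vfield f xh xhd (u t) (u (t - tau))
  + (output xh - y t) *: K.

(* Main.v *)
Require Import Defs.
From mathcomp Require Import ring lra.

Set Implicit Arguments.
Unset Strict Implicit.
Unset Printing Implicit Defensive.

(** Let [e = xh - x] be the observation error and [w = D e] its rescaling by
    the diagonal matrix [D] with entries [eps ^+ i].  The powers of [eps] in
    the gain are chosen so that [D] conjugates the linear part of the error
    equation to [eps^-1 *: (A + L C)] ([scale_error_dynamics]), while the
    weighted norms of the growth assumption become plain l1 norms of rescaled
    vectors ([wnorm1E]).  Write [V = w^T P w].  The Lyapunov equation turns the
    linear part of [V'] into [- eps^-1 |w|^2]; the nonlinear part is bounded
    with the first growth inequality and with [|.|_1 <= n |.|], and the product
    of current and delayed norms that arises is split by Young's inequality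
    ([lyapunov_derivative_le]):
      [V'(t) <= - a |w(t)|^2 + |w(t - tau)|^2],
      [a = eps^-1 - 2 n gamma1 |P| - n^2 gamma2^2 |P|^2].
    Since [lambda_min P <= |P|] ([lambda_min_le_opnorm]), the condition on
    [eps] gives [a > 1].

    The delayed term is absorbed by a Lyapunov-Krasovskii functional
    ([krasovskii_decay]): for a small rate [alpha > 0],
      [W(t) = exp(alpha t) V(t)
              + int_(t - tau)^t exp(alpha (s + tau)) |w(s)|^2 ds]
    is nonincreasing, because the strict inequality [1 < a] leaves room for
    [alpha |P| + exp(alpha tau) <= a] ([exists_decay_rate]).  Hence
    [exp(alpha t) V(t) <= W(0)], and [W(0)] is at most a constant times the
    square of the maximum of [|e|] over the initial interval.  Finally [V]
    controls [|w|^2] from below because [P] is positive definite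
    ([posdef_coercive]), and undoing the scaling and taking square roots gives
    the estimate with rate [alpha / 2].

    Every constant depends only on [n], [P], [eps], [tau] and the growth
    constants, so that the same rate and factor serve all solutions. *)

(** * Bilinear forms *)

Definition bil (R : realType) (n : nat) (M : 'M[R]_n) (x y : 'cV[R]_n) : R :=
  (x^T *m M *m y) 0 0.

Lemma bilC (R : realType) (n : nat) (M : 'M[R]_n) (x y : 'cV[R]_n) :
  M^T = M -> bil M x y = bil M y x.
Proof.
move=> Msym; rewrite /bil -[LHS](mxE trmx_key (fun i j => _ j i)).
by rewrite -/(trmx _) !trmx_mul trmxK Msym mulmxA.
Qed.

Lemma bilDl (R : realType) (n : nat) (M : 'M[R]_n) (x y z : 'cV[R]_n) :
  bil M (x + y) z = bil M x z + bil M y z.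
Proof. by rewrite /bil linearD !mulmxDl mxE. Qed.

Lemma bilDr (R : realType) (n : nat) (M : 'M[R]_n) (x y z : 'cV[R]_n) :
  bil M x (y + z) = bil M x y + bil M x z.
Proof. by rewrite /bil mulmxDr mxE. Qed.

Lemma bilZl (R : realType) (n : nat) (M : 'M[R]_n) (c : R) (x y : 'cV[R]_n) :
  bil M (c *: x) y = c * bil M x y.
Proof. by rewrite /bil linearZ /= -!scalemxAl mxE. Qed.

Lemma bilZr (R : realType) (n : nat) (M : 'M[R]_n) (c : R) (x y : 'cV[R]_n) :
  bil M x (c *: y) = c * bil M x y.
Proof. by rewrite /bil -scalemxAr mxE. Qed.

Lemma bil_mulmx (R : realType) (n : nat) (M D : 'M[R]_n) (x y : 'cV[R]_n) :
  bil M (D *m x) (D *m y) = bil (D^T *m M *m D) x y.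
Proof. by rewrite /bil trmx_mul !mulmxA. Qed.

Lemma posdef_bil_ge0 (R : realType) (n : nat) (M : 'M[R]_n) (x : 'cV[R]_n) :
  posdefmx M -> 0 <= bil M x x.
Proof.
move=> [_ Mpos]; have [->|x0] := eqVneq x 0; last exact/ltW/Mpos.
by rewrite /bil mulmx0 mxE.
Qed.

(** The form is nonnegative at [bil M y y *: x - bil M x y *: y]; this is the
    usual discriminant argument, with denominators cleared. *)
Lemma cauchy_schwarz (R : realType) (n : nat) (M : 'M[R]_n) (x y : 'cV[R]_n) :
  posdefmx M -> bil M x y ^+ 2 <= bil M x x * bil M y y.
Proof.
move=> Mpd; have [Msym Mpos] := Mpd.
have [->|y0] := eqVneq y 0; first by rewrite /bil !mulmx0 mxE expr0n mulr0.
have by0 : 0 < bil M y y by exact: Mpos.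
have := posdef_bil_ge0 (bil M y y *: x - bil M x y *: y) Mpd.
rewrite -scaleNr !(bilDl, bilDr, bilZl, bilZr) (bilC y x Msym).
set a := bil M x x; set b := bil M x y; set c := bil M y y => H.
have : 0 <= c * (a * c - b ^+ 2).
  by apply: le_trans H _; lra.
by rewrite pmulr_rge0 ?subr_ge0.
Qed.

(** * Euclidean and operator norms *)

Lemma enorm_ge0 (R : realType) (n : nat) (x : 'cV[R]_n) : 0 <= enorm x.
Proof. exact: sqrtr_ge0. Qed.

Lemma sqr_enorm_sum (R : realType) (n : nat) (x : 'cV[R]_n) :
  enorm x ^+ 2 = \sum_(i < n) x i 0 ^+ 2.
Proof. by rewrite sqr_sqrtr// sumr_ge0// => i _; rewrite sqr_ge0. Qed.

Lemma sqr_enorm (R : realType) (n : nat) (x : 'cV[R]_n) :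
  enorm x ^+ 2 = bil 1%:M x x.
Proof.
rewrite sqr_enorm_sum /bil mulmx1 mxE; apply: eq_bigr => i _.
by rewrite mxE expr2.
Qed.

(** Makes the Euclidean inner product an instance of the results on
    positive definite forms. *)
Lemma posdef1 (R : realType) (n : nat) : posdefmx (1%:M : 'M[R]_n).
Proof.
split=> [|x x0]; first by rewrite trmx1.
rewrite -/(bil _ _ _) -sqr_enorm lt_neqAle sqr_ge0 andbT eq_sym.
apply: contra x0 => /eqP; rewrite sqr_enorm_sum => /eqP.
rewrite psumr_eq0 => [/allP xi0|i _]; last exact: sqr_ge0.
apply/eqP/colP => i; rewrite mxE; apply/eqP.
by rewrite -sqrf_eq0; apply: xi0; rewrite mem_index_enum.
Qed.

Lemma enorm_eq0 (R : realType) (n : nat) (x : 'cV[R]_n) :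
  (enorm x == 0) = (x == 0).
Proof.
apply/idP/idP => [/eqP x0|/eqP->].
  apply: contraTT isT => /(proj2 (posdef1 R n)).
  by rewrite -/(bil _ _ _) -sqr_enorm x0 expr0n ltxx.
by rewrite -sqrf_eq0 sqr_enorm /bil mulmx0 mxE.
Qed.

Lemma enormZ (R : realType) (n : nat) (c : R) (x : 'cV[R]_n) :
  enorm (c *: x) = `|c| * enorm x.
Proof.
rewrite /enorm -sqrtr_sqr -sqrtrM ?sqr_ge0// mulr_sumr.
by congr Num.sqrt; apply: eq_bigr => i _; rewrite mxE exprMn.
Qed.

Lemma bil1_le (R : realType) (n : nat) (x y : 'cV[R]_n) :
  `|bil 1%:M x y| <= enorm x * enorm y.
Proof.
rewrite -(@ler_pXn2r _ 2)// ?nnegrE ?mulr_ge0 ?enorm_ge0//.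
rewrite real_normK ?num_real// exprMn !sqr_enorm; apply: cauchy_schwarz.
exact: posdef1.
Qed.

Lemma coord_le_enorm (R : realType) (n : nat) (x : 'cV[R]_n) (i : 'I_n) :
  `|x i 0| <= enorm x.
Proof.
rewrite -sqrtr_sqr ler_wsqrtr// (bigD1 i)//= lerDl.
by apply: sumr_ge0 => j _; exact: sqr_ge0.
Qed.

Lemma norm1_le_enorm (R : realType) (n : nat) (x : 'cV[R]_n) :
  \sum_(i < n) `|x i 0| <= n%:R * enorm x.
Proof.
apply: (@le_trans _ _ (\sum_(i < n) enorm x)).
  by apply: ler_sum => i _; exact: coord_le_enorm.
by rewrite sumr_const card_ord mulr_natl.
Qed.

Lemma enorm_le_norm1 (R : realType) (n : nat) (x : 'cV[R]_n) :
  enorm x <= \sum_(i < n) `|x i 0|.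
Proof.
have s0 : 0 <= \sum_(i < n) `|x i 0| by apply: sumr_ge0.
rewrite -(@ler_pXn2r _ 2)// ?nnegrE ?enorm_ge0// sqr_enorm_sum expr2 mulr_suml.
apply: ler_sum => i _; rewrite -real_normK ?num_real// expr2 ler_wpM2l//.
by rewrite (bigD1 i)//= lerDl sumr_ge0.
Qed.

Lemma opnorm_has_sup (R : realType) (m n : nat) (M : 'M[R]_(m, n)) :
  has_sup [set enorm (M *m x) | x in [set x : 'cV[R]_n | enorm x <= 1]].
Proof.
split.
  exists (enorm (M *m 0)), 0 => //=.
  by have /eqP -> : enorm (0 : 'cV[R]_n) == 0 by rewrite enorm_eq0.
exists (\sum_(i < m) \sum_(j < n) `|M i j|) => _ [x /= x1 <-].
apply: le_trans (enorm_le_norm1 _) _; apply: ler_sum => i _.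
rewrite mxE; apply: le_trans (ler_norm_sum _ _ _) _; apply: ler_sum => j _.
by rewrite normrM ler_piMr// (le_trans (coord_le_enorm _ _)).
Qed.

Lemma opnorm_ge0 (R : realType) (m n : nat) (M : 'M[R]_(m, n)) :
  0 <= opnorm M.
Proof.
have e0 : enorm (0 : 'cV[R]_n) = 0 by apply/eqP; rewrite enorm_eq0.
apply: (le_trans (enorm_ge0 (M *m 0))).
by apply: sup_upper_bound; [exact: opnorm_has_sup|exists 0 => //=; rewrite e0].
Qed.

Lemma enorm_mulmx (R : realType) (m n : nat) (M : 'M[R]_(m, n))
    (x : 'cV[R]_n) : enorm (M *m x) <= opnorm M * enorm x.
Proof.
have [->|x0] := eqVneq x 0.
  have /eqP -> : enorm (M *m (0 : 'cV[R]_n)) == 0 by rewrite enorm_eq0 mulmx0.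
  by rewrite mulr_ge0 ?enorm_ge0 ?opnorm_ge0.
have ex0 : 0 < enorm x by rewrite lt_neqAle enorm_ge0 eq_sym enorm_eq0 x0.
rewrite -ler_pdivrMr// mulrC -[_^-1]ger0_norm ?invr_ge0 ?enorm_ge0//.
rewrite -enormZ scalemxAr; apply: sup_upper_bound; first exact: opnorm_has_sup.
exists ((enorm x)^-1 *: x) => //=.
by rewrite enormZ ger0_norm ?invr_ge0 ?enorm_ge0// mulVf// gt_eqF.
Qed.

Lemma bil_le (R : realType) (n : nat) (M : 'M[R]_n) (x y : 'cV[R]_n) :
  bil M x y <= opnorm M * enorm x * enorm y.
Proof.
have -> : bil M x y = bil 1%:M x (M *m y) by rewrite /bil mulmx1 mulmxA.
apply: le_trans (ler_norm _) _; apply: le_trans (bil1_le _ _) _.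
by rewrite mulrC mulrAC ler_wpM2r ?enorm_ge0 ?enorm_mulmx.
Qed.

(** * Spectral bounds *)

(** An eigenvalue [a] with eigenvector [v] satisfies
    [|a| |v| = |M v| <= |M| |v|]; if there is no eigenvalue, the infimum is
    [0] by convention and the bound is trivial. *)
Lemma lambda_min_le_opnorm (R : realType) (n : nat) (M : 'M[R]_n) :
  M^T = M -> lambda_min M <= opnorm M.
Proof.
move=> Msym.
have eig_le (a : R) : eigenvalue M a -> `|a| <= opnorm M.
  move=> /eigenvalueP[v vM v0].
  have vT0 : 0 < enorm v^T.
    by rewrite lt_neqAle enorm_ge0 eq_sym enorm_eq0 trmx_eq0 v0.
  rewrite -(ler_pM2r vT0) -enormZ -linearZ /= -vM trmx_mul Msym.
  exact: enorm_mulmx.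
have [M0|/set0P[a Ma]] := eqVneq [set a : R | eigenvalue M a] set0.
  by rewrite /lambda_min M0 inf0 opnorm_ge0.
apply: le_trans (le_trans (ler_norm a) (eig_le _ Ma)).
apply: ge_inf => //; exists (- opnorm M) => b /eig_le.
by rewrite ler_norml => /andP[].
Qed.

Lemma posdef_unitmx (R : realType) (n : nat) (M : 'M[R]_n) :
  posdefmx M -> M \in unitmx.
Proof.
move=> [_ Mpos]; rewrite -row_free_unit -kermx_eq0; apply/rowV0P => v.
move=> /sub_kermxP vM; apply: trmx_inj; rewrite trmx0; apply/eqP.
by apply: contraTT isT => /Mpos; rewrite trmxK vM mul0mx mxE ltxx.
Qed.

(** Here [|invmx M|^-1] takes the place of the smallest eigenvalue.  Put
    [y = invmx M *m x]; then [bil M x y = |x|^2] and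
    [bil M y y = (y, x) <= |invmx M| |x|^2], so that Cauchy-Schwarz reads
    [|x|^4 <= bil M x x * |invmx M| |x|^2]. *)
Lemma posdef_coercive (R : realType) (n : nat) (M : 'M[R]_n) (x : 'cV[R]_n) :
  posdefmx M -> enorm x ^+ 2 <= opnorm (invmx M) * bil M x x.
Proof.
move=> Mpd; have Mu := posdef_unitmx Mpd; set N := invmx M.
have [->|x0] := eqVneq x 0; first by rewrite sqr_enorm /bil !mulmx0 mxE mulr0.
have ex0 : 0 < enorm x ^+ 2.
  by rewrite exprn_gt0// lt_neqAle enorm_ge0 eq_sym enorm_eq0 x0.
have H1 : bil M x (N *m x) = enorm x ^+ 2.
  by rewrite sqr_enorm /bil mulmx1 mulmxA mulmxK.
have H2 : bil M (N *m x) (N *m x) <= opnorm N * enorm x ^+ 2.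
  have -> : bil M (N *m x) (N *m x) = bil 1%:M (N *m x) x.
    by rewrite /bil mulmx1 mulmxA mulmxK.
  apply: le_trans (ler_norm _) _; apply: le_trans (bil1_le _ _) _.
  by rewrite expr2 mulrA ler_wpM2r ?enorm_ge0 ?enorm_mulmx.
have := cauchy_schwarz x (N *m x) Mpd; rewrite H1 => H3.
rewrite -(ler_pM2r ex0) -expr2; apply: le_trans H3 _.
rewrite [leRHS]mulrAC [leRHS]mulrC.
by apply: ler_wpM2l H2; exact: posdef_bil_ge0.
Qed.

(** * Calculus along a trajectory *)

Lemma is_derive_coord (R : realType) (n : nat) (w : R -> 'cV[R]_n) (t : R)
    (dw : 'cV[R]_n) (i : 'I_n) :
  is_derive t 1 w dw -> is_derive t 1 (fun s => w s i 0) (dw i 0).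
Proof.
move=> [dw1 dw2]; have dwi := (derivable_mxP w t 1).1 dw1.
apply: DeriveDef; first exact: dwi.
by rewrite -dw2 derive_mx// mxE.
Qed.

Lemma bilE (R : realType) (n : nat) (M : 'M[R]_n) (x y : 'cV[R]_n) :
  bil M x y = \sum_(i < n) \sum_(j < n) M i j * (x i 0 * y j 0).
Proof.
rewrite /bil -mulmxA mxE; apply: eq_bigr => i _; rewrite !mxE mulr_sumr.
by apply: eq_bigr => j _; rewrite mulrCA.
Qed.

Lemma is_derive_bil (R : realType) (n : nat) (M : 'M[R]_n) (w : R -> 'cV[R]_n)
    (t : R) (dw : 'cV[R]_n) :
  M^T = M -> is_derive t 1 w dw ->
  is_derive t 1 (fun s => bil M (w s) (w s)) (2 * bil M (w t) dw).
Proof.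
move=> Msym wdw.
have dterm i j : is_derive t 1 (fun s => M i j * (w s i 0 * w s j 0))
    (M i j * (w t i 0 * dw j 0 + dw i 0 * w t j 0)).
  have di := is_derive_coord i wdw; have dj := is_derive_coord j wdw.
  have H := is_deriveZ (M i j) (is_deriveM di dj).
  apply: is_derive_eq (H) _.
  by rewrite /GRing.scale/= [w t j 0 * _]mulrC.
have -> : 2 * bil M (w t) dw = bil M (w t) dw + bil M dw (w t).
  by rewrite (bilC dw) // mulr_natl mulr2n.
have -> : (fun s => bil M (w s) (w s)) =
   \sum_(i < n) \sum_(j < n) (fun s => M i j * (w s i 0 * w s j 0)).
  apply/funext => s; rewrite bilE fct_sumE; apply: eq_bigr => i _.
  by rewrite fct_sumE.
apply: is_derive_eq; rewrite !bilE -big_split; apply: eq_bigr => i _ /=.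
rewrite -big_split; apply: eq_bigr => j _ /=; ring.
Qed.

Lemma continuous_bil (R : realType) (n : nat) (M : 'M[R]_n)
    (w : R -> 'cV[R]_n) :
  continuous w -> continuous (fun s => bil M (w s) (w s)).
Proof.
move=> cw s.
have cc i : (fun r => w r i 0) @ s --> w s i 0.
  exact: (@cvg_comp _ _ _ w (fun v => v i 0) _ _ _ (cw s)
    (@coord_continuous R n 1 i 0 (w s))).
have csum (F : 'I_n -> R -> R) : (forall i, F i @ s --> F i s) ->
    (fun r => \sum_(i < n) F i r) @ s --> \sum_(i < n) F i s.
  move=> cF; rewrite (_ : (fun r => _) = \sum_(i < n) F i); last first.
    by apply/funext => r; rewrite fct_sumE.
  apply: (@big_ind2 _ _ (fun (f : R -> R) (l : R) => f @ s --> l)) => //.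
    exact: cvg_cst.
  by move=> f1 l1 f2 l2; exact: cvgD.
have -> : (fun r => bil M (w r) (w r)) =
   (fun r => \sum_(i < n) \sum_(j < n) (M i j * (w r i 0 * w r j 0))).
  by apply/funext => r; rewrite bilE.
apply: (csum (fun i r => \sum_(j < n) M i j * (w r i 0 * w r j 0))) => i.
apply: (csum (fun j r => M i j * (w r i 0 * w r j 0))) => j.
by apply: cvgM; [exact: cvg_cst|apply: cvgM; exact: cc].
Qed.

(** Composing with [Num.max a] extends a function on a half-line by a constant
    to the left, so that continuity holds on the whole line. *)
Lemma continuous_clamp (R : realType) (T : topologicalType) (a : R)
    (w : R -> T) :
  {within `[a, +oo[, continuous w} -> continuous (fun s => w (Num.max a s)).
Proof.
move=> /subspace_continuousP cw s.
have Amax (r : R) : `[a, +oo[%classic (Num.max a r).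
  by rewrite /= in_itv/= andbT le_max lexx.
have cmax : Num.max a r @[r --> s] --> Num.max a s.
  by apply: continuous_max; [exact: cvg_cst|exact: cvg_id].
move=> U /(cw _ (Amax s)) /cmax.
by apply: (@filterS _ (nbhs s)) => r; apply; exact: Amax.
Qed.

Lemma exists_antiderivative (R : realType) (g : R -> R) (c : R) :
  continuous g -> exists G : R -> R, forall t, c < t -> is_derive t 1 G (g t).
Proof.
move=> cg; pose G x := (\int[lebesgue_measure]_(t in [set` `[c, x]]) g t)%R.
exists G => t ct.
have tt1 : t < t + 1 by rewrite ltrDl.
have gi : lebesgue_measure.-integrable `[c, t + 1] (EFin \o g).
  apply: continuous_compact_integrable; first exact: segment_compact.
  exact: continuous_subspaceT.
have [dG <-] := continuous_FTC1_closed tt1 gi ct (cg t).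
by rewrite derive1E; exact: derivableP.
Qed.

(** * Decay of a delayed Lyapunov inequality *)

(** The functional [W] of the proof is [exp(alpha t) V] plus [b] times the
    integral over [[t - tau, t]] of [g(s) = exp(alpha (s + tau)) q(s)].  With an
    antiderivative [G] of [g], differentiating the integral amounts to
    differentiating [G t - G (t - tau)], which yields
    [W' <= exp(alpha t) (alpha p - a + b exp(alpha tau)) q <= 0]: the shift by
    [tau] in the weight of [g] makes the two delayed terms cancel. *)
Lemma krasovskii_decay (R : realType) (V q : R -> R) (a b p tau alpha Q : R) :
  0 < tau -> 0 <= b -> 0 <= p -> 0 <= alpha ->
  alpha * p + b * expR (alpha * tau) <= a ->
  continuous q -> continuous V ->
  (forall t, 0 <= q t /\ V t <= p * q t) ->
  (forall t : R, 0 < t ->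
     exists2 dV : R, is_derive t 1 V dV & dV <= - a * q t + b * q (t - tau)) ->
  (forall s : R, - tau <= s <= 0 -> q s <= Q) ->
  forall t : R, 0 <= t ->
    V t <= (p + b * tau * expR (alpha * tau)) * Q * expR (- alpha * t).
Proof.
move=> tau0 b0 p0 al0 Ha cq cV qV dV qQ t t0.
have dexp (c s : R) : is_derive s 1 (fun r => expR (c * r)) (c * expR (c * s)).
  have H : is_derive s 1 (fun r : R => c * r) c.
    have := is_deriveZ c (is_derive_id s (1:R)).
    by rewrite /GRing.scale/= mulr1.
  by have := is_derive1_comp (is_derive_expR (c * s)) H; rewrite mulrC.
pose g s := expR (alpha * (s + tau)) * q s.
have cg : continuous g.
  move=> s; apply: cvgM; last exact: cq.
  have cm : (fun r => alpha * (r + tau)) @ s --> alpha * (s + tau).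
    apply: cvgM; first exact: cvg_cst.
    by apply: cvgD; [exact: cvg_id|exact: cvg_cst].
  exact: (@cvg_comp _ _ _ _ expR _ _ _ cm (@continuous_expR R _)).
(* One unit of margin to the left of [- tau] makes [G] two-sidedly
   differentiable, hence continuous, at every point that occurs. *)
have [G dG] := exists_antiderivative (- tau - 1) cg.
pose W s := expR (alpha * s) * V s + b * (G s - G (s - tau)).
have cG (s : R) : - tau - 1 < s -> {for s, continuous G}.
  move=> sG; apply: differentiable_continuous; apply/derivable1_diffP.
  by have [] := dG s sG.
have dW (s : R) : 0 < s -> exists2 dW : R, is_derive s 1 W dW & dW <= 0.
  move=> s0; have [dv Hdv dvle] := dV s s0.
  have dGs : is_derive s 1 G (g s) by apply: dG; lra.
  have dGd : is_derive s 1 (fun r => G (r - tau)) (g (s - tau)).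
    have H : is_derive s 1 (fun r : R => r - tau) 1.
      by have := is_deriveB (is_derive_id s (1:R)) (is_derive_cst tau s (1:R));
         rewrite subr0.
    have H' : is_derive (s - tau) 1 G (g (s - tau)) by apply: dG; lra.
    have := @is_derive1_comp _ G (fun r => r - tau) _ _ _ H' H.
    by rewrite mulr1.
  exists (expR (alpha * s) * dv + alpha * expR (alpha * s) * V s
          + b * (g s - g (s - tau))).
    have H1 := is_deriveM (dexp alpha s) Hdv.
    have H2 := is_deriveZ b (is_deriveB dGs dGd).
    apply: is_derive_eq (is_deriveD H1 H2) _.
    by rewrite /GRing.scale/=; ring.
  have [qs Vs] := qV s.
  rewrite /g subrK [alpha * (s + tau)]mulrDr expRD.
  set E := expR (alpha * s); set T := expR (alpha * tau).
  have E0 : 0 < E by exact: expR_gt0.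
  have -> : E * dv + alpha * E * V s + b * (E * T * q s - E * q (s - tau)) =
    E * (dv + alpha * V s + b * T * q s - b * q (s - tau)) by ring.
  rewrite pmulr_rle0//.
  have aV : alpha * V s <= alpha * (p * q s) by exact: ler_wpM2l.
  have aq : (alpha * p + b * T) * q s <= a * q s by exact: ler_wpM2r.
  lra.
have W_le : W t <= W 0.
  apply: (ler0_derive1_nincry _ _ _ (lexx 0) t0).
  - by move=> s; rewrite in_itv/= andbT => /dW[d [? _] _].
  - by move=> s; rewrite in_itv/= andbT derive1E => /dW[d [_ ->] d0].
  - apply: continuous_in_subspaceT => s; rewrite inE/= in_itv/= andbT => s0.
    apply: cvgD.
      apply: cvgM; last exact: cV.
      have cm : (fun r => alpha * r) @ s --> alpha * s.
        by apply: cvgM; [exact: cvg_cst|exact: cvg_id].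
      exact: (@cvg_comp _ _ _ _ expR _ _ _ cm (@continuous_expR R _)).
    apply: cvgM; first exact: cvg_cst.
    apply: cvgB; first by apply: cG; lra.
    have cs : (fun r => r - tau) @ s --> s - tau.
      by apply: cvgB; [exact: cvg_id|exact: cvg_cst].
    by apply: (@cvg_comp _ _ _ _ G _ _ _ cs); apply: cG; lra.
have G_mono (r s : R) : - tau - 1 < r -> r <= s -> G r <= G s.
  move=> r1 rs; apply: (ger0_derive1_ndecr _ _ _ (lexx r) rs (lexx s)).
  - move=> z; rewrite in_itv/= => /andP[rz _].
    by have [] : is_derive z 1 G (g z) by apply: dG; lra.
  - move=> z; rewrite in_itv/= derive1E => /andP[rz _].
    have [_ ->] : is_derive z 1 G (g z) by apply: dG; lra.
    by rewrite mulr_ge0 ?expR_ge0//; case: (qV z).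
  - apply: continuous_in_subspaceT => z; rewrite inE/= in_itv/= => /andP[rz _].
    by apply: cG; lra.
have Q0 : 0 <= Q.
  by apply: (le_trans (proj1 (qV 0))); apply: qQ; lra.
have G0 : G 0 - G (- tau) <= tau * expR (alpha * tau) * Q.
  have Nt : - tau <= 0 by lra.
  have [] := @MVT_segment R G g (- tau) 0 Nt.
  - move=> z; rewrite in_itv/= => /andP[rz _].
    by apply: dG; lra.
  - apply: continuous_in_subspaceT => z; rewrite inE/= in_itv/= => /andP[rz _].
    by apply: cG; lra.
  move=> c; rewrite in_itv/= => cI ->; rewrite sub0r opprK /g.
  rewrite mulrC -[leRHS]mulrA; apply: ler_wpM2l; first exact: ltW.
  apply: ler_pM; rewrite ?expR_ge0//; first by case: (qV c).
    by rewrite ler_expR ler_wpM2l//; lra.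
  exact: qQ.
have Gt : 0 <= G t - G (t - tau) by rewrite subr_ge0; apply: G_mono; lra.
have V0 : V 0 <= p * Q.
  apply: le_trans (proj2 (qV 0)) _; apply: ler_wpM2l => //.
  by apply: qQ; lra.
rewrite mulNr expRN ler_pdivlMr ?expR_gt0//.
move: W_le; rewrite /W mulr0 expR0 mul1r sub0r => W_le.
have bG0 : b * (G 0 - G (- tau)) <= b * (tau * expR (alpha * tau) * Q).
  exact: ler_wpM2l.
have bGt : 0 <= b * (G t - G (t - tau)) by exact: mulr_ge0.
rewrite mulrC.
apply: (@le_trans _ _ (p * Q + b * (tau * expR (alpha * tau) * Q))).
  lra.
by lra.
Qed.

(** The left-hand side is continuous in [alpha] and equals [b] at [0]. *)
Lemma exists_decay_rate (R : realType) (a b p tau : R) :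
  b < a -> exists2 alpha, 0 < alpha & alpha * p + b * expR (alpha * tau) <= a.
Proof.
move=> ba.
have cf : (fun r : R => r * p + b * expR (r * tau)) @ (0:R) --> b.
  rewrite [X in _ --> X](_ : b = 0 * p + b * expR (0 * tau)); last first.
    by rewrite !mul0r expR0 add0r mulr1.
  apply: cvgD; first by apply: cvgM; [exact: cvg_id|exact: cvg_cst].
  apply: cvgM; first exact: cvg_cst.
  have cm : (fun r : R => r * tau) @ (0:R) --> (0:R) * tau.
    by apply: cvgM; [exact: cvg_id|exact: cvg_cst].
  exact: (@cvg_comp _ _ _ _ expR _ _ _ cm (@continuous_expR R _)).
have small : \forall r \near (0:R)^'+, r * p + b * expR (r * tau) < a.
  by move/cvg_at_right_filter : cf => /cvgr_lt; apply.
near (0:R)^'+ => r.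
exists r; first by near: r; exact: nbhs_right_gt.
by apply: ltW; near: r.
Unshelve. all: by end_near. Qed.

(** * High-gain scaling of the error *)

Definition scale_mx (R : realType) (n : nat) (eps : R) : 'M[R]_n :=
  diag_mx (\row_(i < n) eps ^+ i).

Lemma scale_mxE (R : realType) (n : nat) (eps : R) (x : 'cV[R]_n) (i : 'I_n) :
  (scale_mx n eps *m x) i 0 = eps ^+ i * x i 0.
Proof. by rewrite mul_diag_mx !mxE. Qed.

Lemma scale_mxK (R : realType) (n : nat) (eps : R) (x : 'cV[R]_n) :
  eps != 0 -> scale_mx n eps^-1 *m (scale_mx n eps *m x) = x.
Proof.
move=> eps0; apply/colP => i.
by rewrite !scale_mxE mulrA -exprMn mulVf// expr1n mul1r.
Qed.

Lemma wnorm1E (R : realType) (n : nat) (eps : R) (x : 'cV[R]_n) :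
  0 < eps -> wnorm1 eps x = \sum_(i < n) `|(scale_mx n eps *m x) i 0|.
Proof.
move=> eps0; apply: eq_bigr => i _.
by rewrite scale_mxE normrM [`|eps ^+ i|]ger0_norm// exprn_ge0// ltW.
Qed.

(** The shift matrix satisfies [D A = eps^-1 A D], because it maps weight
    [i + 1] to weight [i]; the output reads only coordinate [0], of weight [1],
    and the gain compensates the weight of each row up to one factor
    [eps^-1]. *)
Lemma scale_error_dynamics (R : realType) (n : nat) (eps : R)
    (L e : 'cV[R]_n) : eps != 0 ->
  scale_mx n eps *m (chain_mx R n *m e + output e *: gain L eps) =
  eps^-1 *: ((chain_mx R n + L *m out_mx R n) *m (scale_mx n eps *m e)).
Proof.
move=> eps0; apply/colP => i.
have mD (a b : 'cV[R]_n) : (a + b) i 0 = a i 0 + b i 0 by rewrite mxE.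
have mZ (c : R) (a : 'cV[R]_n) : (c *: a) i 0 = c * a i 0 by rewrite mxE.
rewrite scale_mxE mulmxDl mZ !mD mZ !mulrDr; congr (_ + _).
  rewrite !mxE !mulr_sumr; apply: eq_bigr => j _; rewrite scale_mxE mxE.
  have [->|_] := eqVneq (j : nat) i.+1; last by rewrite !mul0r !mulr0.
  by rewrite !mul1r exprS -mulrA mulKf.
rewrite -mulmxA [(L *m _) i 0]mxE big_ord1 [gain _ _ _ _]mxE.
have -> : (out_mx R n *m (scale_mx n eps *m e)) 0 0 = output e.
  rewrite /output !mxE; apply: eq_bigr => j _; rewrite scale_mxE !mxE.
  have [->|_] := eqVneq (j : nat) 0%N; last by rewrite !mul0r.
  by rewrite expr0 !mul1r.
rewrite exprSr; set E := eps ^+ i.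
have E0 : E != 0 by rewrite expf_neq0.
by field; rewrite eps0 E0.
Qed.

(** The left-hand side is the derivative of [w^T P w] along the rescaled
    error [w], expressed pointwise in the current and delayed states of plant
    and observer. *)
Lemma lyapunov_derivative_le (R : realType) (n m : nat)
    (f : 'I_n -> 'cV[R]_n -> 'cV[R]_n -> 'cV[R]_m -> 'cV[R]_m -> R)
    (gamma1 gamma2 gamma3 : R -> R) (L : 'cV[R]_n) (P : 'M[R]_n)
    (eps tau t : R) (u : R -> 'cV[R]_m) (y : R -> R)
    (x xd xh xhd : 'cV[R]_n) :
  assumptionA1 f gamma1 gamma2 gamma3 -> 0 < eps -> P^T = P ->
  (chain_mx R n + L *m out_mx R n)^T *m P
    + P *m (chain_mx R n + L *m out_mx R n) = - 1%:M ->
  y t = output x ->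
  2 * bil P (scale_mx n eps *m (xh - x))
    (scale_mx n eps *m (observer f tau u (gain L eps) y t xh xhd
                        - plant f tau u t x xd)) <=
  - (eps^-1 - 2 * n%:R * gamma1 eps * opnorm P
     - n%:R ^+ 2 * gamma2 eps ^+ 2 * opnorm P ^+ 2)
    * enorm (scale_mx n eps *m (xh - x)) ^+ 2
  + enorm (scale_mx n eps *m (xhd - xd)) ^+ 2.
Proof.
move=> A1 eps0 Psym; set AL := _ + L *m _ => PL yt.
have [g1 g2 _ fL] := A1 eps eps0.
have [{}fL _] := fL xh x xhd xd (u t) (u (t - tau)) 0.
set df := vfield f xh _ _ _ - _ in fL.
set D := scale_mx n eps in fL *.
set e := D *m (xh - x); set ed := D *m (xhd - xd).
have -> : D *m (observer f tau u (gain L eps) y t xh xhd - plant f tau u t x xd)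
    = eps^-1 *: (AL *m e) + D *m df.
  rewrite -scale_error_dynamics ?gt_eqF// -mulmxDr; congr (_ *m _).
  have -> : output (xh - x) = output xh - output x.
    by rewrite /output mulmxBr !mxE.
  rewrite /observer /plant yt /df mulmxBr opprD !addrA; congr (_ - _).
  by rewrite [LHS]addrAC [RHS]addrAC; congr (_ + _); exact: addrAC.
rewrite bilDr bilZr mulrDr.
have bAL (v : 'cV[R]_n) : 2 * bil P v (AL *m v) = - enorm v ^+ 2.
  have -> : 2 * bil P v (AL *m v) = bil P v (AL *m v) + bil P (AL *m v) v.
    by rewrite (bilC (AL *m v))// mulr_natl mulr2n.
  have -> : - enorm v ^+ 2 = bil (- 1%:M) v v.
    by rewrite sqr_enorm /bil mulmxN mulNmx [RHS]mxE.
  by rewrite -PL /bil trmx_mul mulmxDr mulmxDl [RHS]mxE [RHS]addrC !mulmxA.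
have df_le : enorm (D *m df) <=
    n%:R * (gamma1 eps * enorm e + gamma2 eps * enorm ed).
  apply: le_trans (enorm_le_norm1 _) _; rewrite -wnorm1E//.
  apply: le_trans fL _; rewrite !wnorm1E// mulrDr; apply: lerD.
    by rewrite mulrCA ler_pM2l// norm1_le_enorm.
  by rewrite mulrCA ler_pM2l// norm1_le_enorm.
have bdf : bil P e (D *m df) <= opnorm P * enorm e *
    (n%:R * (gamma1 eps * enorm e + gamma2 eps * enorm ed)).
  apply: le_trans (bil_le _ _ _) _; apply: ler_wpM2l df_le.
  by rewrite mulr_ge0 ?opnorm_ge0 ?enorm_ge0.
(* Young's inequality in the weighting that leaves the coefficient 1 in front
   of the delayed term. *)
have young : 0 <= (n%:R * gamma2 eps * opnorm P * enorm e - enorm ed) ^+ 2.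
  exact: sqr_ge0.
have -> : 2 * (eps^-1 * bil P e (AL *m e)) = - (eps^-1 * enorm e ^+ 2).
  by rewrite mulrCA bAL mulrN.
move: bdf young; set b := bil _ _ _; move: (enorm e) (enorm ed) (opnorm P).
by move=> r s p bdf young; lra.
Qed.

(** * Exponential convergence of the observer *)

Theorem theorem1 (R : realType) (n m : nat) (n_gt0 : (0 < n)%N)
    (f : 'I_n -> 'cV[R]_n -> 'cV[R]_n -> 'cV[R]_m -> 'cV[R]_m -> R)
    (f_smooth : forall i : 'I_n,
      smooth (fun z : 'cV[R]_n * 'cV[R]_n * 'cV[R]_m * 'cV[R]_m =>
                f i z.1.1.1 z.1.1.2 z.1.2 z.2))
    (f_0 : forall i : 'I_n, f i 0 0 0 0 = 0)
    (gamma1 gamma2 gamma3 : R -> R)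
    (A1 : assumptionA1 f gamma1 gamma2 gamma3)
    (tau : R) (tau_gt0 : 0 < tau)
    (u : R -> 'cV[R]_m) (u_cont : {within `[- tau, +oo[, continuous u})
    (L : 'cV[R]_n) (AL_hurwitz : hurwitz (chain_mx R n + L *m out_mx R n))
    (P : 'M[R]_n) (P_posdef : posdefmx P)
    (P_lyap : (chain_mx R n + L *m out_mx R n)^T *m P
              + P *m (chain_mx R n + L *m out_mx R n) = - 1%:M)
    (eps : R) (eps_gt0 : 0 < eps)
    (eps_cond : lambda_min P / (eps * opnorm P)
                - 2 * n%:R * gamma1 eps * opnorm P
                - n%:R ^+ 2 * gamma2 eps ^+ 2 * opnorm P ^+ 2 - 1 > 0) :
  exists alpha beta : R, [/\ 0 < alpha, 0 < beta &
    forall phi phih x xh : R -> 'cV[R]_n,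
      {within `[- tau, 0], continuous phi} ->
      {within `[- tau, 0], continuous phih} ->
      dde_solution tau (plant f tau u) phi x ->
      dde_solution tau
        (observer f tau u (gain L eps) (fun t => output (x t))) phih xh ->
      forall t : R, 0 <= t ->
        enorm (xh t - x t)
          <= beta * sup [set enorm (xh s - x s) | s in `[- tau, 0]]
             * expR (- alpha * t)].
Proof.
have [Psym _] := P_posdef.
pose p := opnorm P; have p0 : 0 <= p by exact: opnorm_ge0.
pose a := eps^-1 - 2 * n%:R * gamma1 eps * p
          - n%:R ^+ 2 * gamma2 eps ^+ 2 * p ^+ 2.
have a_gt1 : 1 < a.
  have : lambda_min P / (eps * p) <= eps^-1.
    have [->|p_neq0] := eqVneq p 0.
      by rewrite mulr0 invr0 mulr0 invr_ge0 ltW.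
    have p_gt0 : 0 < p by rewrite lt_neqAle eq_sym p_neq0.
    rewrite invfM mulrCA ger_pMr ?invr_gt0// ler_pdivrMr// mul1r.
    exact: lambda_min_le_opnorm.
  by move: eps_cond; rewrite -/p /a; lra.
have [alpha al0 Hal] := exists_decay_rate p tau a_gt1.
pose D := scale_mx n eps; pose D' := scale_mx n eps^-1.
pose B := p + 1 * tau * expR (alpha * tau).
have B0 : 0 <= B by rewrite addr_ge0// mul1r mulr_ge0 ?expR_ge0// ltW.
pose k := opnorm (invmx P); have k0 : 0 <= k by exact: opnorm_ge0.
pose c := opnorm D' ^+ 2 * (k * (B * opnorm D ^+ 2)).
have c0 : 0 <= c.
  have sqr0 (r : R) : 0 <= r ^+ 2 by exact: sqr_ge0.
  exact: (mulr_ge0 _ (mulr_ge0 k0 (mulr_ge0 B0 _))).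
exists (alpha / 2), (Num.sqrt c + 1); split.
- by rewrite divr_gt0.
- by rewrite ltr_wpDl ?sqrtr_ge0.
move=> phi phih x xh _ _ [_ cx _ dx] [_ cxh _ dxh] t t0.
(* The error, frozen to the left of [- tau] so as to be continuous on the
   whole line. *)
pose w s := xh (Num.max (- tau) s) - x (Num.max (- tau) s).
have wE s : - tau <= s -> w s = xh s - x s by move=> ts; rewrite /w max_r.
have cw : continuous w.
  move=> s.
  by apply: cvgB; [exact: (continuous_clamp cxh)|exact: (continuous_clamp cx)].
pose V s := bil P (D *m w s) (D *m w s).
pose q s := enorm (D *m w s) ^+ 2.
have cV : continuous V.
  rewrite (_ : V = fun s => bil (D^T *m P *m D) (w s) (w s)).
    exact: continuous_bil.
  by apply/funext => s; rewrite /V bil_mulmx.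
have cq : continuous q.
  rewrite (_ : q = fun s => bil (D^T *m 1%:M *m D) (w s) (w s)).
    exact: continuous_bil.
  by apply/funext => s; rewrite /q sqr_enorm bil_mulmx.
set S := sup _.
have w_le_S s : - tau <= s <= 0 -> enorm (w s) <= S.
  move=> sI; have /andP[ts _] := sI.
  apply: sup_upper_bound; last first.
    by exists s; [rewrite /= in_itv|rewrite wE].
  split; first by exists (enorm (xh s - x s)), s => //=; rewrite in_itv.
  have tau0 : - tau <= 0 by lra.
  have cw2 : {within `[- tau, 0], continuous (fun r => bil 1%:M (w r) (w r))}.
    by apply: continuous_subspaceT; exact: continuous_bil.
  have [r rI rmax] := EVT_max tau0 cw2.
  exists (enorm (w r)) => _ [z /= zI <-].
  rewrite -wE; last by move: zI; rewrite in_itv/= => /andP[].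
  rewrite -(@ler_pXn2r _ 2)// ?nnegrE ?enorm_ge0// !sqr_enorm.
  exact: rmax.
have S0 : 0 <= S by apply: le_trans (enorm_ge0 (w 0)) (w_le_S 0 _); lra.
have qV s : 0 <= q s /\ V s <= p * q s.
  split; first exact: sqr_ge0.
  by apply: le_trans (bil_le _ _ _) _; rewrite -mulrA -expr2.
have dV (s : R) : 0 < s ->
    exists2 dV : R, is_derive s 1 V dV & dV <= - a * q s + 1 * q (s - tau).
  move=> s0.
  set dws := observer f tau u (gain L eps) (fun t => output (x t)) s
               (xh s) (xh (s - tau)) - plant f tau u s (x s) (x (s - tau)).
  have dw : is_derive s 1 w dws.
    apply: near_eq_is_derive (is_deriveB (dxh s s0) (dx s s0)).
    have : \forall r \near s, - tau < r by apply: lt_nbhsr; lra.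
    by apply: filterS => r /ltW /wE ->.
  exists (2 * bil P (D *m w s) (D *m dws)).
    rewrite bil_mulmx (_ : V = fun s => bil (D^T *m P *m D) (w s) (w s)).
      by apply: is_derive_bil dw; rewrite !trmx_mul trmxK Psym mulmxA.
    by apply/funext => r; rewrite /V bil_mulmx.
  rewrite mul1r /q !wE; [|lra..].
  by apply: lyapunov_derivative_le => //; exact: A1.
have qQ (s : R) : - tau <= s <= 0 -> q s <= (opnorm D * S) ^+ 2.
  move=> sI; rewrite ler_pXn2r// ?nnegrE ?mulr_ge0 ?opnorm_ge0 ?enorm_ge0//.
  by apply: le_trans (enorm_mulmx _ _) _; rewrite ler_wpM2l ?opnorm_ge0 ?w_le_S.
have Vt := krasovskii_decay tau_gt0 ler01 p0 (ltW al0) Hal cq cV qV dV qQ t0.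
have wt : enorm (w t) ^+ 2 <= opnorm D' ^+ 2 * (k * V t).
  rewrite -{1}(scale_mxK (w t) (lt0r_neq0 eps_gt0)) -/D -/D'.
  apply: (@le_trans _ _ ((opnorm D' * enorm (D *m w t)) ^+ 2)).
    rewrite ler_pXn2r// ?nnegrE ?mulr_ge0 ?opnorm_ge0 ?enorm_ge0//.
    exact: enorm_mulmx.
  by rewrite exprMn ler_wpM2l ?sqr_ge0//; exact: posdef_coercive.
rewrite -wE; last by lra.
(* Taking the square root of the estimate halves the exponent. *)
set E := expR _; have E0 : 0 <= E by exact: expR_ge0.
have E2 : expR (- alpha * t) = E ^+ 2.
  by rewrite /E expr2 -expRD; congr expR; lra.
have bSE : Num.sqrt c * S * E <= (Num.sqrt c + 1) * S * E.
  by rewrite ler_wpM2r// ler_wpM2r// lerDl.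
apply: le_trans bSE.
rewrite -(@ler_pXn2r _ 2)// ?nnegrE ?enorm_ge0 ?mulr_ge0 ?sqrtr_ge0//.
apply: (le_trans wt); rewrite !exprMn sqr_sqrtr// -E2.
apply: (@le_trans _ _ (opnorm D' ^+ 2 *
    (k * (B * (opnorm D * S) ^+ 2 * expR (- alpha * t))))).
  by apply: ler_wpM2l; [exact: sqr_ge0|exact: ler_wpM2l].
by rewrite /c; lra.
Qed.
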